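(* Let $G$ be a simple weighted graph on $n$ vertices, let $a$ be the maximal weight of an edge of $G$, and let $1\le m\le n-1$. Then $\lambda_{m+1}(G)\le d_m(G)+ma-\delta(G_{S_m})$.
   Context: A weighted graph $G$ is a simple graph with a positive weight $w_{ij}$ on each edge $\{i,j\}$. Its adjacency matrix $A(G)$ has entries $a_{ij}=w_{ij}$ if $\{i,j\}$ is an edge and $0$ otherwise; the degree of vertex $v_i$ is $d_i(G)=\sum_j a_{ij}$, and $D(G)$ is the diagonal matrix of degrees. The Laplacian is $L(G)=D(G)-A(G)$, with eigenvalues $0=\lambda_1(G)\le\dots\le\lambda_n(G)$. The vertices are labeled $v_1,\dots,v_n$ so that $d_1(G)\le d_2(G)\le\dots\le d_n(G)$. Let $S_m=\{v_1,\dots,v_m\}$ (the $m$ vertices of smallest degree) and let $G_{S_m}$ be the weighted subgraph of $G$ induced by $S_m$. For a weighted graph $H$, $\delta(H)$ denotes the smallest (weighted) degree of a vertex of $H$. *)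

(* Defs.v *)
From HB Require Import structures.
From mathcomp Require Import all_boot all_order all_algebra.
From mathcomp Require Import polyrcf reals.

Set Implicit Arguments.
Unset Strict Implicit.
Unset Printing Implicit Defensive.

Import Order.TTheory GRing.Theory Num.Theory.
Local Open Scope ring_scope.

Section WeightedGraph.
Variable R : realType.

(* The values of [weight] on non-edges are irrelevant. *)
Record wgraph (V : finType) := WGraph {
  edge : rel V;
  weight : V -> V -> R;
  edge_sym : symmetric edge;
  edge_irr : irreflexive edge;
  weight_sym : forall x y, edge x y -> weight x y = weight y x;
  weight_gt0 : forall x y, edge x y -> 0 < weight x y
}.

Section Basic.
Variables (V : finType) (G : wgraph V).

Definition adj (x y : V) : R := if edge G x y then weight G x y else 0.

Definition deg (x : V) : R := \sum_y adj x y.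

(* Weights are positive, so the initial value 0 of the iterated maximum only
   matters for an edgeless graph, which gets the value 0. *)
Definition max_weight : R :=
  \big[Num.max/0]_(e : V * V | edge G e.1 e.2) weight G e.1 e.2.

(* The minimum is over the whole of V; it is given the value 0 if V is empty. *)
Definition min_deg : R :=
  if [pick x : V] is Some x0 then \big[Num.min/deg x0]_(x : V) deg x else 0.

Variable S : {set V}.

Definition induced_edge : rel {x : V | x \in S} :=
  fun x y => edge G (val x) (val y).

Definition induced_weight (x y : {x : V | x \in S}) : R :=
  weight G (val x) (val y).

Fact induced_edge_sym : symmetric induced_edge.
Proof. by move=> x y; apply: edge_sym. Qed.

Fact induced_edge_irr : irreflexive induced_edge.
Proof. by move=> x; apply: edge_irr. Qed.

Fact induced_weight_sym x y :
  induced_edge x y -> induced_weight x y = induced_weight y x.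
Proof. exact: weight_sym. Qed.

Fact induced_weight_gt0 x y : induced_edge x y -> 0 < induced_weight x y.
Proof. exact: weight_gt0. Qed.

Definition induced : wgraph {x : V | x \in S} :=
  WGraph induced_edge_sym induced_edge_irr
         induced_weight_sym induced_weight_gt0.

End Basic.

(* The real eigenvalues of A in nondecreasing order, each repeated according to
   its algebraic multiplicity ([rootsR p] lists the distinct real roots of p in
   increasing order). For a symmetric A of size n this list has length n. *)
Definition eigenvalues n (A : 'M[R]_n) : seq R :=
  flatten [seq nseq (mup x (char_poly A)) x | x <- rootsR (char_poly A)].

Section Labelled.
Variables (n : nat) (G : wgraph 'I_n).

Definition adjacency : 'M[R]_n := \matrix_(i, j) adj G i j.

Definition degree_matrix : 'M[R]_n := diag_mx (\row_i deg G i).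

Definition laplacian : 'M[R]_n := degree_matrix - adjacency.

(* [lambda k] is the k-th smallest Laplacian eigenvalue for 1 <= k <= n,
   counting from 1. *)
Definition lambda (k : nat) : R := nth 0 (eigenvalues laplacian) k.-1.

(* The vertex labelled v_k is the ordinal with value k - 1. *)
Definition degree_ordered : Prop :=
  forall i j : 'I_n, (i <= j)%N -> deg G i <= deg G j.

Definition first_vertices (m : nat) : {set 'I_n} := [set i : 'I_n | (i < m)%N].

End Labelled.

End WeightedGraph.

(* Main.v *)
(** For [y] supported on [S = {v_1, ..., v_m}] and a constant [c], the Laplacian
    form does not change when [c] is added to every entry, and comparing the
    weights inside [S] with the constant weight [a] gives
    [y L y <= sum_i (d_i - d_i(G_S) + m a) y_i^2 - a (sum_i y_i)^2].
    Each coefficient is at most [B = min (d_m + m a - delta(G_S), n a)], and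
    [B <= n a] makes the last term absorb the loss from the shift by [c]:
    [|y|^2 <= |y + c 1|^2 + (sum_i y_i)^2 / n].  Hence the Rayleigh quotient
    is at most [B] on the span of [R^S] and the all-ones vector, which has
    dimension [m + 1], and Courant-Fischer bounds [lambda_{m+1}]. *)
Require Import Defs.
From HB Require Import structures.
From mathcomp Require Import all_boot all_order all_algebra.
From mathcomp Require Import polyrcf reals.
From mathcomp Require Import complex ring lra.

Set Implicit Arguments.
Unset Strict Implicit.
Unset Printing Implicit Defensive.

Import Order.TTheory GRing.Theory Num.Theory.
Local Open Scope ring_scope.

(** * Characteristic polynomials and the sorted list of eigenvalues *)

Lemma char_poly_similar (F : fieldType) n (P A : 'M[F]_n) :
  P \in unitmx -> char_poly (invmx P *m A *m P) = char_poly A.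
Proof.
move=> Pu; rewrite /char_poly /char_poly_mx !map_mxM /=.
set Q := map_mx polyC (invmx P); set S := map_mx polyC P.
have QS : Q *m S = 1%:M by rewrite -map_mxM mulVmx // map_mx1.
have -> : 'X%:M - Q *m map_mx polyC A *m S = Q *m ('X%:M - map_mx polyC A) *m S.
  by rewrite mulmxBr mulmxBl mul_mx_scalar -scalemxAl QS scalemx1.
by rewrite !det_mulmx mulrAC -det_mulmx QS det1 mul1r.
Qed.

Lemma mup_prod_XsubC (F : fieldType) (rs : seq F) (x : F) :
  mup x (\prod_(r <- rs) ('X - r%:P)) = count_mem x rs.
Proof.
elim: rs => [|r rs IH]; first by rewrite big_nil mupNroot // root1.
rewrite big_cons mupM ?polyXsubC_eq0 ?IH //=; last first.
  by apply/monic_neq0/monic_prod_XsubC.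
by rewrite -['X - _]expr1 mup_XsubCX; case: eqP.
Qed.

(** The multiplicity of a root of the split polynomial is its number of occurrences in [rs], so
    [eigenvalues] regroups [rs] by value. *)
Lemma eigenvalues_perm (R : realType) n (A : 'M[R]_n) (rs : seq R) :
  char_poly A = \prod_(r <- rs) ('X - r%:P) -> perm_eq (eigenvalues A) rs.
Proof.
move=> eA; have p0 : char_poly A != 0 by exact/monic_neq0/char_poly_monic.
rewrite /eigenvalues; apply: perm_trans (perm_count_undup rs).
rewrite eA; under eq_map do rewrite mup_prod_XsubC.
apply/perm_flatten/perm_map/uniq_perm; last 1 first.
- move=> x; rewrite -eA -roots_on_rootsR // in_itv /= mem_undup eA.
  by rewrite root_prod_XsubC.
- exact/lt_sorted_uniq/sorted_roots.
- exact: undup_uniq.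
Qed.

Lemma eigenvalues_sorted (R : realType) n (A : 'M[R]_n) :
  sorted <=%R (eigenvalues A).
Proof.
rewrite /eigenvalues le_sorted_pairwise.
have : pairwise <%R (rootsR (char_poly A)).
  by rewrite -lt_sorted_pairwise sorted_roots.
elim: rootsR => //= x s IH /andP[xs /IH {}IH].
rewrite pairwise_cat IH andbT; apply/andP; split.
  apply/allrelP=> y z /nseqP[-> _] /flatten_mapP[t /(allP xs) xt /nseqP[-> _]].
  exact: ltW.
by elim: mup => //= k ->; rewrite andbT; apply/allP => y /nseqP[->].
Qed.

(** If entry [k] exceeded [B], so would all later ones, leaving at most [k] entries [<= B]. The
    count also puts [k] inside the list, so the default 0 of [nth] is never read. *)
Lemma le_nth_sorted (R : realDomainType) (s : seq R) (k : nat) (B : R) :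
  sorted <=%R s -> (k < count (<= B) s)%N -> nth 0 s k <= B.
Proof.
move=> ss kB; rewrite leNgt; apply/negP => Bk; move: kB.
rewrite ltnNge -[in X in ~~ X](cat_take_drop k s) count_cat.
have -> : count (<= B) (drop k s) = 0%N; last first.
  by rewrite addn0 (leq_trans (count_size _ _)) // size_take_min geq_minl.
apply/eqP; rewrite -leqn0 leqNgt -has_count -all_predC; apply/(all_nthP 0) => i.
rewrite size_drop ltn_subRL nth_drop /= -ltNge => ki.
apply: lt_le_trans Bk _; apply: (sorted_leq_nth le_trans) => //; last exact: leq_addr.
by rewrite inE (leq_ltn_trans _ ki) // leq_addr.
Qed.

(* The spectral theorem is only available over the complexification [R[i]]; real
   quadratic forms are recovered by splitting a complex row vector into its real
   and imaginary parts. *)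
Section Rayleigh.
Variables (R : realType) (n : nat) (A : 'M[R]_n).
Hypothesis A_sym : A^T = A.
Let C := R[i].
Local Notation toC := (map_mx (real_complex R)).
Local Notation "M ^t*" := (map_mx Num.conj (M^T)) (at level 30).

(** A real symmetric matrix is Hermitian over [C], so its spectral diagonal is real and descends to
    [R]. The rows of [P] are orthonormal left eigenvectors. *)
Lemma real_spectral : exists (P : 'M[C]_n) (r : 'rV[R]_n),
  P *m P ^t* = 1%:M /\ toC A = P ^t* *m diag_mx (toC r) *m P.
Proof.
have Aherm : toC A \is hermsymmx.
  apply: realsym_hermsym.
    by apply/is_hermitianmxP/matrixP=> i j; rewrite expr0 scale1r !mxE -[in LHS]A_sym mxE.
  by apply/mxOverP => i j; rewrite mxE; apply/complex_realP; exists (A i j).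
exists (spectralmx (toC A)), (map_mx (@complex.Re R) (spectral_diag (toC A))).
split; first exact/unitarymxP/spectral_unitarymx.
have -> : toC (map_mx (@complex.Re R) (spectral_diag (toC A))) = spectral_diag (toC A).
  apply/rowP => i; rewrite !mxE.
  by have /mxOverP /(_ 0 i) /complex_realP[k ->] := hermitian_spectral_diag_real Aherm.
rewrite -invmx_unitary ?spectral_unitarymx //.
exact/orthomx_spectralP/hermitian_normalmx.
Qed.

Lemma Re_sum I (s : seq I) (F : I -> C) :
  complex.Re (\sum_(i <- s) F i) = \sum_(i <- s) complex.Re (F i).
Proof. by apply: big_morph => // [[a b] [c d]]. Qed.

Lemma Im_sum I (s : seq I) (F : I -> C) :
  complex.Im (\sum_(i <- s) F i) = \sum_(i <- s) complex.Im (F i).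
Proof. by apply: big_morph => // [[a b] [c d]]. Qed.

Lemma diag_form (d x : 'rV[R]_n) :
  (x *m diag_mx d *m x^T) 0 0 = \sum_i d 0 i * x 0 i ^+ 2.
Proof.
rewrite mul_mx_diag mxE; apply: eq_bigr => i _; rewrite !mxE; ring.
Qed.

(** With [X = u + i w], the cross terms [i (w M u^T - u M w^T)] are purely imaginary. *)
Lemma Re_quadratic_form (M : 'M[R]_n) (X : 'rV[C]_n)
    (u := map_mx (@complex.Re R) X) (w := map_mx (@complex.Im R) X) :
  complex.Re ((X *m toC M *m X ^t*) 0 0)
  = (u *m M *m u^T) 0 0 + (w *m M *m w^T) 0 0.
Proof.
rewrite !mxE Re_sum -big_split; apply: eq_bigr => j _ /=.
rewrite !mxE !mulr_suml Re_sum -big_split; apply: eq_bigr => i _ /=.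
rewrite !mxE; case: (X 0 i) (X 0 j) => [a b] [c d] /=; ring.
Qed.

(** One half of Courant-Fischer. Were at most [k] eigenvalues [<= B], some nonzero complex
    combination of the rows of [U] would be orthogonal to their eigenvectors, and the form would
    exceed [B] times the squared norm there. *)
Lemma nth_eigenvalue_le k (U : 'M[R]_(k.+1, n)) (B : R) :
    row_free U ->
    (forall x : 'rV_n, (x <= U)%MS -> (x *m A *m x^T) 0 0 <= B * (x *m x^T) 0 0) ->
  nth 0 (eigenvalues A) k <= B.
Proof.
move=> U_free leB; have [P [r [PP A_spec]]] := real_spectral.
have PtP : P ^t* *m P = 1%:M by exact: mulmx1C.
have charA : char_poly A = \prod_(x <- [seq r 0 i | i <- enum 'I_n]) ('X - x%:P).
  apply/(map_poly_inj (real_complex R)); rewrite map_char_poly A_spec.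
  have Pu : P \in unitmx by case: (mulmx1_unit PP).
  have -> : P ^t* = invmx P by rewrite -[LHS]mulmx1 -(mulmxV Pu) mulmxA PtP mul1mx.
  rewrite char_poly_similar // char_poly_trig ?diag_mx_is_trig //.
  rewrite big_map rmorph_prod /= big_enum /=; apply: eq_bigr => i _.
  by rewrite !mxE eqxx mulr1n rmorphB /= map_polyX map_polyC.
apply: (le_nth_sorted (eigenvalues_sorted A)).
have /permP -> := eigenvalues_perm charA.
pose I := [pred i | r 0 i <= B].
have -> : count (<= B) [seq r 0 i | i <- enum 'I_n] = #|I|.
  by rewrite count_map cardE size_filter enumT.
rewrite ltnNge; apply/negP => I_le.
pose Z := colsub (enum_val : 'I_#|I| -> 'I_n) (toC U *m P ^t*).
(* A combination of the rows of [U] with no component along the eigenvectors of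
   eigenvalue [<= B]. *)
have /rowV0Pn[v /sub_kermxP vZ v_neq0] : kermx Z != 0.
  rewrite kermx_eq0 /row_free neq_ltn (leq_ltn_trans (rank_leq_col _)) //.
pose X := v *m toC U; pose Y := X *m P ^t*.
have Y0 i : r 0 i <= B -> Y 0 i = 0.
  move=> riB; have iI : i \in I by [].
  move/rowP/(_ (enum_rank_in iI i)): vZ; rewrite /Y /X -mulmxA !mxE => vZ.
  by rewrite -[RHS]vZ; apply: eq_bigr => l _; rewrite [in RHS]mxE enum_rankK_in.
have X_neq0 : X != 0.
  apply: contra_neq v_neq0 => X0; apply: (row_free_inj (A := toC U)).
    by rewrite /row_free mxrank_map.
  by rewrite mul0mx.
have XY : X = Y *m P by rewrite /Y -mulmxA PtP mulmx1.
have XAX : X *m toC A *m X ^t* = Y *m toC (diag_mx r) *m Y ^t*.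
  rewrite A_spec map_diag_mx !mulmxA -/Y -mulmxA; congr (_ *m _).
  by rewrite XY trmx_mul map_mxM mulmxA PP mul1mx.
have XX : X *m toC 1%:M *m X ^t* = Y *m toC 1%:M *m Y ^t*.
  by rewrite map_mx1 !mulmx1 [in X ^t*]XY trmx_mul map_mxM mulmxA.
(* Since [U] is real, both parts of [X] lie in its real row space, where [leB] applies. *)
have sub_Re : (map_mx (@complex.Re R) X <= U)%MS.
  apply/submxP; exists (map_mx (@complex.Re R) v); apply/rowP => j.
  rewrite !mxE Re_sum; apply: eq_bigr => l _; rewrite !mxE.
  by case: (v 0 l) => a b /=; rewrite mulr0 subr0.
have sub_Im : (map_mx (@complex.Im R) X <= U)%MS.
  apply/submxP; exists (map_mx (@complex.Im R) v); apply/rowP => j.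
  rewrite !mxE Im_sum; apply: eq_bigr => l _; rewrite !mxE.
  by case: (v 0 l) => a b /=; rewrite mulr0 add0r.
have := lerD (leB _ sub_Re) (leB _ sub_Im).
have norm_form (x : 'rV[R]_n) : x *m x^T = x *m 1%:M *m x^T by rewrite mulmx1.
rewrite -Re_quadratic_form -mulrDr !norm_form -Re_quadratic_form XAX XX.
rewrite -diag_const_mx !Re_quadratic_form !diag_form -!big_split /= mulr_sumr.
rewrite -subr_ge0 -sumrB => ge0.
have {ge0} : \sum_i (r 0 i - B) * (complex.Re (Y 0 i) ^+ 2 + complex.Im (Y 0 i) ^+ 2) <= 0.
  rewrite -oppr_ge0 -sumrN (le_trans ge0) // le_eqVlt; apply/orP; left.
  by apply/eqP/eq_bigr => i _; rewrite !mxE; ring.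
(* Coordinates of [Y] with [r 0 i <= B] vanish, so a nonpositive sum of these terms forces
   [Y = 0]. *)
have term_ge0 i : 0 <= (r 0 i - B) * (complex.Re (Y 0 i) ^+ 2 + complex.Im (Y 0 i) ^+ 2).
  case: (leP (r 0 i) B) => riB; first by rewrite Y0 //= expr0n /= addr0 mulr0.
  by rewrite mulr_ge0 ?subr_ge0 ?(ltW riB) // addr_ge0 ?sqr_ge0.
rewrite le_eqVlt ltNge sumr_ge0 // orbF psumr_eq0 // => /allP Yz.
case/eqP: X_neq0; rewrite XY; suff -> : Y = 0 by rewrite mul0mx.
apply/rowP => i; rewrite [RHS]mxE.
case: (leP (r 0 i) B) => [/Y0 //|riB].
have := Yz i (mem_index_enum i); rewrite mulf_eq0 subr_eq0 gt_eqF //=.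
rewrite paddr_eq0 ?sqr_ge0 // !sqrf_eq0.
by case: (Y 0 i) => a b /= /andP[/eqP -> /eqP ->].
Qed.
End Rayleigh.

(** * Energy estimates for weighted graphs *)

Lemma sum_sqr_diff (R : comPzRingType) (V : finType) (w : V -> V -> R)
    (x : V -> R) :
  (forall i j, w i j = w j i) ->
  \sum_i \sum_j w i j * (x i - x j) ^+ 2
  = 2 * (\sum_i (\sum_j w i j) * x i ^+ 2 - \sum_i \sum_j w i j * (x i * x j)).
Proof.
move=> w_sym.
have -> : \sum_i (\sum_j w i j) * x i ^+ 2 = \sum_i \sum_j w i j * x i ^+ 2.
  by apply: eq_bigr => i _; rewrite mulr_suml.
have E : \sum_i \sum_j w i j * x i ^+ 2 = \sum_i \sum_j w i j * x j ^+ 2.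
  rewrite exchange_big; apply: eq_bigr => i _; apply: eq_bigr => j _.
  by rewrite w_sym.
rewrite mulrBr mulr_natl mulr2n {2}E mulr_sumr -big_split -sumrB /=.
apply: eq_bigr => i _; rewrite mulr_sumr -big_split -sumrB /=.
by apply: eq_bigr => j _; ring.
Qed.

Section WeightedGraph.
Variables (R : realType) (V : finType) (G : wgraph R V).

Lemma adj_sym i j : adj G i j = adj G j i.
Proof. by rewrite /adj edge_sym; case: ifP => // /weight_sym. Qed.

Lemma adj_ge0 i j : 0 <= adj G i j.
Proof. by rewrite /adj; case: ifP => // /weight_gt0/ltW. Qed.

Lemma max_weight_ge0 : 0 <= max_weight G.
Proof.
rewrite /max_weight; elim/big_ind: _ => // [x y x0 y0|e /weight_gt0/ltW //].
by rewrite le_max x0.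
Qed.

Lemma adj_le_max_weight i j : adj G i j <= max_weight G.
Proof.
rewrite /adj; case: ifP => [e|_]; last exact: max_weight_ge0.
exact: (le_bigmax_cond _ (fun e : V * V => weight G e.1 e.2) (j := (i, j))).
Qed.

Lemma deg_induced (S : {set V}) (i : {i : V | i \in S}) :
  deg (induced G S) i = \sum_(j in S) adj G (val i) j.
Proof. by rewrite big_sub. Qed.

Lemma min_deg_le i : min_deg G <= deg G i.
Proof. by rewrite /min_deg; case: pickP => [x _|/(_ i)//]; exact: bigmin_le. Qed.

(** Twice the Laplacian form, as each edge is counted in both orders. *)
Definition energy (x : V -> R) : R := \sum_i \sum_j adj G i j * (x i - x j) ^+ 2.

(** The right side minus the left is the energy of [y] for the nonnegative weights
    [max_weight G - adj G i j] on pairs inside [S]. *)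
Lemma energy_le_supported (S : {set V}) (y : V -> R) :
  (forall i, i \notin S -> y i = 0) ->
  energy y <= 2 * (\sum_i (deg G i - \sum_(j in S) adj G i j
                           + #|S|%:R * max_weight G) * y i ^+ 2
                   - max_weight G * (\sum_i y i) ^+ 2).
Proof.
move=> yS; pose s i : R := (i \in S)%:R.
have sy i : s i * y i = y i.
  by rewrite /s; case: (boolP (i \in S)) => [_|/yS ->]; rewrite ?mul1r ?mulr0.
(* Diagonal entries are kept: they do not affect squared differences, and they make the row sums
   contain [#|S|%:R * max_weight G] and complete the square of [\sum_i y i]. *)
pose w i j := s i * s j * (max_weight G - adj G i j).
have w_ge0 : 0 <= \sum_i \sum_j w i j * (y i - y j) ^+ 2.
  do 2!(apply: sumr_ge0 => ? _).
  rewrite mulr_ge0 ?sqr_ge0 // mulr_ge0 ?subr_ge0 ?adj_le_max_weight //.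
  by rewrite mulr_ge0 ?ler0n.
rewrite -subr_ge0 (le_trans w_ge0) // sum_sqr_diff; last first.
  by move=> i j; rewrite /w adj_sym (mulrC (s i)).
rewrite /energy (sum_sqr_diff y adj_sym) -mulrBr ler_pM2l // le_eqVlt.
have wy : \sum_i \sum_j w i j * (y i * y j)
  = max_weight G * (\sum_i y i) ^+ 2 - \sum_i \sum_j adj G i j * (y i * y j).
  rewrite expr2 mulr_suml mulr_sumr -sumrB; apply: eq_bigr => i _.
  rewrite !mulr_sumr -sumrB; apply: eq_bigr => j _.
  transitivity ((max_weight G - adj G i j) * ((s i * y i) * (s j * y j))).
    by rewrite /w; ring.
  by rewrite !sy; ring.
have wd : \sum_i (\sum_j w i j) * y i ^+ 2
  = \sum_i (#|S|%:R * max_weight G - \sum_(j in S) adj G i j) * y i ^+ 2.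
  apply: eq_bigr => i _; rewrite -[in RHS](sy i).
  have -> : #|S|%:R * max_weight G - \sum_(j in S) adj G i j
    = \sum_j s j * (max_weight G - adj G i j).
    rewrite mulr_natl -sumr_const -sumrB big_mkcond; apply: eq_bigr => j _.
    by rewrite /s; case: ifP; rewrite ?mul1r ?mul0r.
  rewrite !mulr_suml; apply: eq_bigr => j _.
  rewrite /w /s; case: (i \in S); rewrite /=; ring.
apply/orP; left; apply/eqP; rewrite wy wd.
transitivity (\sum_i (deg G i - \sum_(j in S) adj G i j + #|S|%:R * max_weight G) * y i ^+ 2
   - \sum_i deg G i * y i ^+ 2
   - (max_weight G * (\sum_i y i) ^+ 2 - \sum_i \sum_j adj G i j * (y i * y j))).
  congr (_ - _); rewrite -sumrB; apply: eq_bigr => i _; ring.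
rewrite /deg; ring.
Qed.

Lemma energy_le (S : {set V}) (y : V -> R) (c B : R) :
  (0 < #|V|)%N -> 0 <= B -> B <= #|V|%:R * max_weight G ->
  (forall i, i \in S ->
     deg G i - \sum_(j in S) adj G i j + #|S|%:R * max_weight G <= B) ->
  (forall i, i \notin S -> y i = 0) ->
  energy (fun i => c + y i) <= 2 * (B * \sum_i (c + y i) ^+ 2).
Proof.
move=> V_gt0 B_ge0 B_le degB yS.
have -> : energy (fun i => c + y i) = energy y.
  apply: eq_bigr => i _; apply: eq_bigr => j _; congr (_ * _ ^+ 2); ring.
apply: le_trans (energy_le_supported yS) _; rewrite ler_pM2l //.
set Y := \sum_i y i.
have -> : \sum_i (c + y i) ^+ 2 = \sum_i y i ^+ 2 + 2 * c * Y + #|V|%:R * c ^+ 2.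
  have -> : #|V|%:R * c ^+ 2 = \sum_(i : V) c ^+ 2 by rewrite sumr_const mulr_natl.
  rewrite mulr_sumr -!big_split /=.
  by apply: eq_bigr => i _; ring.
have yB : \sum_i (deg G i - \sum_(j in S) adj G i j + #|S|%:R * max_weight G) * y i ^+ 2
    <= B * \sum_i y i ^+ 2.
  rewrite mulr_sumr; apply: ler_sum => i _.
  have [/degB iB|/yS ->] := boolP (i \in S); first by rewrite ler_wpM2r ?sqr_ge0.
  by rewrite expr0n /= !mulr0.
set N : R := #|V|%:R in B_le *.
have N_gt0 : 0 < N by rewrite ltr0n.
(* By [yB] it remains to see that the parenthesis is nonnegative. The factor [N] allows completing
   the square in [Y + N * c], and [B_le] handles the remaining multiple of [Y ^+ 2]. *)
have : 0 <= N * (B * (2 * c * Y + N * c ^+ 2) + max_weight G * Y ^+ 2).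
  have -> : N * (B * (2 * c * Y + N * c ^+ 2) + max_weight G * Y ^+ 2)
    = (N * max_weight G - B) * Y ^+ 2 + B * (Y + N * c) ^+ 2 by ring.
  by rewrite addr_ge0 // mulr_ge0 ?sqr_ge0 ?subr_ge0.
rewrite pmulr_rge0 // => ge0.
lra.
Qed.

Lemma deg_excessE (S : {set V}) (i : V) :
  deg G i - \sum_(j in S) adj G i j = \sum_(j in ~: S) adj G i j.
Proof.
rewrite /deg (bigID (mem S)) /= addrAC.
rewrite -[X in X + _ = _]/(\sum_(j in S) _ - \sum_(j in S) _) subrr add0r.
by apply: eq_bigl => j; rewrite inE.
Qed.

(** The excess is the weight from [i] to the complement of [S]: [#|V| - #|S|] terms, each at most
    [max_weight G]. This is what permits capping [B] at [n a]. *)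
Lemma deg_excess_le (S : {set V}) (i : V) :
  deg G i - \sum_(j in S) adj G i j + #|S|%:R * max_weight G
  <= #|V|%:R * max_weight G.
Proof.
rewrite deg_excessE -(cardsC S) natrD mulrDl addrC lerD2l mulr_natl -sumr_const.
by apply: ler_sum => j _; exact: adj_le_max_weight.
Qed.

End WeightedGraph.

(** * The Laplacian matrix and the eigenvalue bound *)

Lemma laplacian_form (R : realType) n (G : wgraph R 'I_n) (x : 'rV[R]_n) :
  2 * (x *m laplacian G *m x^T) 0 0 = energy G (x 0).
Proof.
rewrite /energy (sum_sqr_diff _ (adj_sym G)) /laplacian mulmxBr mulmxBl mxE.
congr (_ * (_ + _)).
  by rewrite /degree_matrix mul_mx_diag mxE; apply: eq_bigr => i _; rewrite !mxE /deg; ring.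
rewrite mxE; congr (- _); rewrite mxE exchange_big; apply: eq_bigr => j _.
rewrite !mxE mulr_suml; apply: eq_bigr => i _; rewrite !mxE; ring.
Qed.

Lemma laplacian_sym (R : realType) n (G : wgraph R 'I_n) :
  (laplacian G)^T = laplacian G.
Proof.
rewrite /laplacian linearB /= tr_diag_mx; congr (_ - _).
by apply/matrixP => i j; rewrite !mxE adj_sym.
Qed.

Theorem theorem4 (R : realType) (n : nat) (G : wgraph R 'I_n)
    (G_ord : degree_ordered G) (m : nat) (m_bounds : (1 <= m <= n.-1)%N)
    (v_m : 'I_n) (v_mE : nat_of_ord v_m = m.-1) :
  lambda G m.+1 <=
    deg G v_m + m%:R * max_weight G - min_deg (induced G (first_vertices n m)).
Proof.
case/andP: m_bounds => m_gt0 m_le.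
have n_gt0 : (0 < n)%N := leq_ltn_trans (leq0n _) (ltn_ord v_m).
have m_lt_n : (m < n)%N by rewrite -(prednK n_gt0) ltnS.
pose S := first_vertices n m; pose a := max_weight G.
have S_mem (i : 'I_n) : (i \in S) = (i < m)%N by rewrite inE.
have cardS : #|S| = m.
  rewrite -sum1_card (eq_bigl _ _ S_mem) -(big_ord_widen n (fun=> 1%N) (ltnW m_lt_n)).
  by rewrite sum1_card card_ord.
pose B := Num.min (deg G v_m + m%:R * a - min_deg (induced G S)) (n%:R * a).
apply: le_trans (_ : B <= _); last by rewrite ge_min lexx.
have degB i : i \in S ->
    deg G i - \sum_(j in S) adj G i j + #|S|%:R * max_weight G <= B.
  move=> iS; have := deg_excess_le G S i.
  rewrite card_ord cardS le_min => ->; rewrite andbT.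
  have := min_deg_le (induced G S) (Sub i iS); rewrite deg_induced SubK.
  (* The index [m - 1] of [v_m] is the largest in [S], so [v_m] has the largest degree there. *)
  have : deg G i <= deg G v_m.
    by apply: G_ord; rewrite v_mE -ltnS prednK // -S_mem.
  rewrite /a; lra.
have B_ge0 : 0 <= B.
  have v_mS : v_m \in S by rewrite S_mem v_mE prednK.
  apply: le_trans (degB _ v_mS); rewrite deg_excessE addr_ge0 //.
    by apply: sumr_ge0 => j _; exact: adj_ge0.
  by rewrite mulr_ge0 ?max_weight_ge0.
(* The first [m] rows are the unit vectors of [S] and the last is the all-ones vector, so [v *m U]
   is the constant [v 0 ord_max] plus the vector [y v] supported on [S]. *)
pose U : 'M[R]_(m.+1, n) :=
  \matrix_(i, j) if (i < m)%N then ((i : nat) == j)%:R else 1.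
pose y (v : 'rV[R]_m.+1) (j : 'I_n) := if (j < m)%N then v 0 (inord j) else 0.
have mulU v j : (v *m U) 0 j = v 0 ord_max + y v j.
  rewrite !mxE big_ord_recr /= mxE ltnn mulr1 addrC; congr (_ + _).
  rewrite /y; case: ifP => [jm|/negbT jm].
    rewrite (bigD1 (Ordinal jm)) //= mxE /= jm eqxx mulr1 big1 ?addr0.
      by congr (v 0 _); apply: val_inj; rewrite /= inordK // ltnW.
    move=> i /negPf ij; rewrite mxE /= ltn_ord (_ : (i : nat) == j = false) ?mulr0 //.
  rewrite big1 // => i _; rewrite mxE /= ltn_ord.
  by case: eqP => [ij|_]; rewrite ?mulr0 //; rewrite -ij ltn_ord in jm.
(* [lambda G m.+1] sits at position [m] of the list, matching the [m.+1] rows of [U]. *)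
apply: (nth_eigenvalue_le (laplacian_sym G) (U := U)).
  apply: inj_row_free => v vU0.
  have vy0 j : v 0 ord_max + y v j = 0 by rewrite -mulU vU0 mxE.
  (* Position [m] exists because [m < n] and lies outside [S], so it isolates the all-ones
     coefficient. *)
  have c0 : v 0 ord_max = 0.
    by have := vy0 (Ordinal m_lt_n); rewrite /y /= ltnn addr0.
  apply/rowP => i; rewrite [RHS]mxE.
  have [im|mi] := ltnP i m; last first.
    rewrite -[RHS]c0; congr (v 0 _); apply: val_inj; apply/eqP.
    by rewrite eqn_leq -ltnS ltn_ord.
  have := vy0 (widen_ord (ltnW m_lt_n) (Ordinal im)).
  by rewrite c0 add0r /y /= im inord_val.
move=> x /submxP[v ->].
rewrite -(ler_pM2l (ltr0n R 2)) laplacian_form.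
have -> : (v *m U *m (v *m U)^T) 0 0 = \sum_j (v 0 ord_max + y v j) ^+ 2.
  by rewrite mxE; apply: eq_bigr => j _; rewrite [_^T _ _]mxE mulU expr2.
have -> : energy G ((v *m U) 0) = energy G (fun j => v 0 ord_max + y v j).
  by apply: eq_bigr => i _; apply: eq_bigr => j _; rewrite !mulU.
apply: (energy_le (S := S)) => //.
- by rewrite card_ord.
- by rewrite card_ord ge_min lexx orbT.
- by move=> j; rewrite S_mem /y => /negPf ->.
Qed.
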